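(* Let $k\ge2$, $n\geq 1$ and let $p_1,\ldots,p_k$ be positive integers. There is a bijection $\Phi$ between the set $\mathcal{C}^n_{p_1,\ldots,p_k}$ of $(p_1,\ldots,p_k)$-colored rooted $k$-cacti of size $n$ and the set $\mathcal{T}^n_{p_1,\ldots,p_k}$ of vertex-labelled tree-rooted $k$-constellations of size $n$ and type $(p_1,\ldots,p_k)$. Moreover, $\Phi$ has the following degree preserving property: for any $C\in\mathcal{C}^n_{p_1,\ldots,p_k}$, any $t\in[k]$, any $i\in[p_t]$ and any $j\in[p_{t+1}]$, the number of edges joining vertices of type $t$ and color $i$ to vertices of type $t+1$ and color $j$ in $C$ is equal to the number of edges joining the vertex of type $t$ labelled $i$ to the vertex of type $t+1$ labelled $j$ in the tree-rooted constellation $\Phi(C)$ (types are taken modulo $k$).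
   Context: $[m]=\{1,\ldots,m\}$. A map is a cellular embedding (all faces simply connected) of a connected graph (loops and multiple edges allowed) in an oriented compact connected surface without boundary, considered up to orientation preserving homeomorphism. A $k$-constellation is a map with black and white faces and with vertices of types $1,\ldots,k$ (types taken modulo $k$) such that (i) each edge separates a black face and a white face, and (ii) each black face has degree $k$ and is incident to vertices of type $1,2,\ldots,k$ in this order clockwise around the face. Black faces are called hyperedges; the size is the number of hyperedges. An edge has type $t\in[k]$ if, clockwise around its incident hyperedge, it goes from a vertex of type $t$ to a vertex of type $t+1$; thus each hyperedge is incident to exactly one vertex and one edge of each type. Standard combinatorial encoding: $k$-constellations with hyperedges labelled by $[n]$ correspond bijectively to tuples $(\pi_1,\ldots,\pi_k)$ of permutations of $[n]$ generating a transitive group, the cycles of $\pi_t$ being the counterclockwise orders of the hyperedges around the vertices of type $t$; the white faces correspond to the cycles of $\pi_1\pi_2\cdots\pi_k$. A constellation is rooted if one hyperedge is distinguished (root hyperedge); its root vertex is the vertex of type $k$ incident to the root hyperedge. A $k$-cactus is a $k$-constellation with a single white face. A $(p_1,\ldots,p_k)$-colored cactus is a $k$-cactus whose vertices of type $t$ are colored with colors in $[p_t]$, every color in $[p_t]$ being used, for every $t\in[k]$. A constellation has type $(p_1,\ldots,p_k)$ if it has $p_t$ vertices of type $t$ for all $t$; it is vertex-labelled if for each $t$ its $p_t$ vertices of type $t$ have distinct labels in $[p_t]$. For a vertex $v_0$ of a constellation $C$, a $v_0$-arborescence of $C$ is a spanning tree $A$ of (the underlying graph of) $C$ such that every vertex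 $v\ne v_0$ of type $t$ is incident to exactly one edge of type $t$ in $A$. A tree-rooted constellation is a pair $(C,A)$ where $C$ is a rooted constellation and $A$ is a $v_0$-arborescence of $C$, with $v_0$ the root vertex of $C$. *)

(* Defs.v *)
From HB Require Import structures.
From mathcomp Require Import all_boot all_fingroup.

Set Implicit Arguments.
Unset Strict Implicit.
Unset Printing Implicit Defensive.

(* Constellations are given by the standard permutation encoding, with
   hyperedges labelled by 'I_n, and considered up to relabelling of the
   hyperedges (cactus_iso and tree_rooted_iso below). The index t : 'I_k stands for
   the vertex type t + 1, so that type k is the index k - 1; the successor of
   a type modulo k is ordS t. *)
Record constellation (k n : nat) := Constellation {
  cperm :> 'I_k -> {perm 'I_n};
  constellation_transitive :
    [transitive <<[set cperm t | t : 'I_k]>>, on [set: 'I_n] | 'P]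
}.

(* Mathcomp composes permutations from left to right. Since the cycles of C t
   are the counterclockwise orders around vertices whereas types increase
   clockwise around hyperedges, the white faces are the cycles of the
   composite of functions C 1 \o ... \o C k, where C k is applied first. *)
Definition white_perm k n (C : constellation k n) : {perm 'I_n} :=
  (\prod_(t < k) C (rev_ord t))%g.

Definition is_cactus k n (C : constellation k n) : Prop :=
  #|porbits (white_perm C)| = 1.

(* Vertices of type t, and vertices of any type. *)
Definition tvertex k n (C : constellation k n) (t : 'I_k) : finType :=
  {v : {set 'I_n} | v \in porbits (C t)}.

Definition vertex k n (C : constellation k n) : finType :=
  {t : 'I_k & tvertex C t}.

(* The vertex of type t incident to the hyperedge h. *)
Definition tvertex_of k n (C : constellation k n) (t : 'I_k) (h : 'I_n) :
    tvertex C t :=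
  exist _ (porbit (C t) h) (imset_f (porbit (C t)) (erefl : h \in 'I_n)).

Definition vertex_of k n (C : constellation k n) (t : 'I_k) (h : 'I_n) :
    vertex C :=
  Tagged (tvertex C) (tvertex_of C t h).

(* Each edge borders exactly one hyperedge, and each hyperedge is incident to
   exactly one edge of each type: (t, h) is the edge of type t of h. *)
Definition edge (k n : nat) : finType := ('I_k * 'I_n)%type.

Definition joins k n (C : constellation k n) (e : edge k n)
    (u v : vertex C) : bool :=
  let a := vertex_of C e.1 e.2 in
  let b := vertex_of C (ordS e.1) e.2 in
  ((u == a) && (v == b)) || ((u == b) && (v == a)).

Definition incident k n (C : constellation k n) (e : edge k n)
    (v : vertex C) : bool :=
  (v == vertex_of C e.1 e.2) || (v == vertex_of C (ordS e.1) e.2).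

Definition spanning_connected k n (C : constellation k n)
    (A : {set edge k n}) : Prop :=
  forall u v : vertex C,
    connect [rel x y | [exists e in A, joins e x y]] u v.

(* A cycle of the multigraph is encoded as a cyclic sequence of pairs (v, e)
   where e joins v to the vertex of the next pair; the vertices are distinct,
   and so are the edges (this matters for length 2, i.e. parallel edges). *)
Definition is_cycle k n (C : constellation k n) (A : {set edge k n})
    (c : seq (vertex C * edge k n)) : bool :=
  [&& c != [::],
      path.cycle (fun x y => joins x.2 x.1 y.1) c,
      uniq (map fst c),
      uniq (map snd c)
    & all (mem A) (map snd c)].

Definition spanning_tree k n (C : constellation k n)
    (A : {set edge k n}) : Prop :=
  spanning_connected C A /\
  (forall c : seq (vertex C * edge k n), ~~ is_cycle A c).

Definition arborescence k n (C : constellation k n) (v0 : vertex C)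
    (A : {set edge k n}) : Prop :=
  spanning_tree C A /\
  (forall v : vertex C, v != v0 ->
     #|[pred e in A | incident e v & e.1 == tag v]| = 1).

(* The index of the type k. *)
Definition last_type k (hk : 1 < k) : 'I_k :=
  Ordinal (eq_leq (prednK (ltnW hk))).

Definition root_vertex k (hk : 1 < k) n (C : constellation k n) (r : 'I_n) :
    vertex C :=
  vertex_of C (last_type hk) r.

(* Assignments of a color (or label) in [p t] to the vertices of type t. *)
Definition coloring k n (p : 'I_k -> nat) (C : constellation k n) :=
  forall t : 'I_k, tvertex C t -> 'I_(p t).

Record colored_rooted_cactus (k n : nat) (p : 'I_k -> nat) := CRCactus {
  crc_map :> constellation k n;
  crc_cactus : is_cactus crc_map;
  crc_root : 'I_n;
  crc_color : coloring p crc_map;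
  crc_color_surj : forall (t : 'I_k) (i : 'I_(p t)),
    exists v : tvertex crc_map t, crc_color v = i
}.

Record labelled_tree_rooted (k : nat) (hk : 1 < k) (n : nat)
    (p : 'I_k -> nat) := LTRooted {
  ltr_map :> constellation k n;
  ltr_type : forall t : 'I_k, #|tvertex ltr_map t| = p t;
  ltr_root : 'I_n;
  ltr_label : coloring p ltr_map;
  ltr_label_inj : forall t : 'I_k, injective (ltr_label (t := t));
  ltr_tree : {set edge k n};
  ltr_arborescence : arborescence (root_vertex hk ltr_map ltr_root) ltr_tree
}.

(* Relabelling of the hyperedges by s. The vertex of type t incident to h is
   mapped to the vertex of type t incident to s h. *)
Definition relabels k n (s : {perm 'I_n}) (C D : constellation k n) : Prop :=
  forall (t : 'I_k) (h : 'I_n), D t (s h) = s (C t h).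

Definition relabels_coloring k n (p : 'I_k -> nat) (s : {perm 'I_n})
    (C D : constellation k n) (f : coloring p C) (g : coloring p D) : Prop :=
  forall (t : 'I_k) (h : 'I_n),
    g t (tvertex_of D t (s h)) = f t (tvertex_of C t h).

Definition cactus_iso k n (p : 'I_k -> nat)
    (C D : colored_rooted_cactus n p) : Prop :=
  exists s : {perm 'I_n},
    [/\ relabels s C D,
        crc_root D = s (crc_root C)
      & relabels_coloring s (@crc_color _ _ _ C) (@crc_color _ _ _ D)].

Definition tree_rooted_iso k (hk : 1 < k) n (p : 'I_k -> nat)
    (C D : labelled_tree_rooted hk n p) : Prop :=
  exists s : {perm 'I_n},
    [/\ relabels s C D,
        ltr_root D = s (ltr_root C),
        relabels_coloring s (@ltr_label _ _ _ _ C) (@ltr_label _ _ _ _ D)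
      & forall (t : 'I_k) (h : 'I_n),
          ((t, s h) \in ltr_tree D) = ((t, h) \in ltr_tree C)].

From mathcomp Require Import classical_sets functions.

(* The sets of isomorphism classes: cactus_iso C, seen as a set, is the class
   of C, and similarly for tree_rooted_iso. *)
Definition cacti k n (p : 'I_k -> nat) :
    set (set (colored_rooted_cactus n p)) :=
  range (@cactus_iso k n p).
Arguments cacti {k} n p _.

Definition tree_rooted k (hk : 1 < k) n (p : 'I_k -> nat) :
    set (set (labelled_tree_rooted hk n p)) :=
  range (@tree_rooted_iso k hk n p).
Arguments tree_rooted {k} hk n p _.

(* Number of edges joining vertices of type t and color i to vertices of type
   t + 1 and color j. Edges are counted by their endpoints only: if k = 2, the
   edges of both types are counted. *)
Definition num_joining k n (p : 'I_k -> nat) (C : constellation k n)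
    (f : coloring p C) (t : 'I_k) (i : 'I_(p t)) (j : 'I_(p (ordS t))) : nat :=
  #|[pred e : edge k n |
      [exists u : tvertex C t, exists v : tvertex C (ordS t),
         [&& joins e (Tagged (tvertex C) u) (Tagged (tvertex C) v),
             f t u == i & f (ordS t) v == j]]]|.

(* Main.v *)
(* Merging the vertices of equal type and color, a colored rooted cactus becomes
   an Eulerian digraph on the pairs (type, color), with one arc (t, h) from the
   vertex of type t to the vertex of type t + 1 of each hyperedge h, together
   with an Eulerian tour of it that starts with the arc (k, root): the boundary
   of the white face. As in the BEST theorem, the tour is determined by the
   order of the arcs out of each vertex, that is, by a cyclic order at each
   vertex and the last arc used at each vertex other than the root vertex; these
   last arcs may be those of any spanning tree oriented towards the root vertex.
   The cyclic orders are the vertices of a constellation with the same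
   hyperedges, and the last arcs form its arborescence. *)

Require Import Defs.
From mathcomp Require Import all_boot all_fingroup.
From mathcomp Require Import zify.

Set Implicit Arguments.
Unset Strict Implicit.
Unset Printing Implicit Defensive.

(** * Cyclic sequences, and walks with prescribed exits in a finite digraph *)

Lemma fcycle_head_unique (T : eqType) (f : T -> T) x s s' :
  fcycle f (x :: s) -> fcycle f (x :: s') -> size s = size s' -> s = s'.
Proof.
rewrite /= !rcons_path => /andP[/fpathE -> _] /andP[/fpathE -> _].
by rewrite !size_traject => ->.
Qed.

Lemma fcycle_last_unique (T : eqType) (f : T -> T) x0 s s' :
  fcycle f s -> fcycle f s' -> size s = size s' ->
  last x0 s = last x0 s' -> s = s'.
Proof.
case/lastP: s => [|s x] cs cs'; first by case: s' cs' => //.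
case/lastP: s' cs' => [|s' x']; first by rewrite size_rcons.
rewrite !size_rcons !last_rcons => cs' [ss] xx'; subst x'.
rewrite (@fcycle_head_unique _ f x s s') //.
- by have := cs; rewrite -(rotr_cycle 1) rotr1_rcons.
- by have := cs'; rewrite -(rotr_cycle 1) rotr1_rcons.
Qed.

(** No exit from a vertex comes after its last exit; this makes the times of last exits increase
    along tree arcs. *)
Lemma index_le_last_filter (T : eqType) (P : pred T) x0 x (w : seq T) :
  uniq w -> x \in filter P w ->
  index x w <= index (last x0 (filter P w)) w.
Proof.
elim/last_ind: w => // w y IH; rewrite rcons_uniq => /andP[yw uw].
rewrite filter_rcons; case: ifP => Py.
  rewrite last_rcons mem_rcons inE mem_filter.
  rewrite -!cats1 !index_cat (negbTE yw) /= eqxx addn0.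
  case: ifP => [_ _|_]; first exact: index_size.
  by rewrite andbF orbF eq_sym => ->; rewrite addn0.
move=> xP; have := IH uw xP; rewrite -!cats1 !index_cat.
have -> : x \in w by move: xP; rewrite mem_filter => /andP[].
suff -> : last x0 (filter P w) \in w by [].
apply: (@mem_subseq _ (filter P w)); first exact: filter_subseq.
by case: (filter P w) xP => //= b s _; exact: mem_last.
Qed.

Section Walks.

Variables (E V : finType) (src tgt : E -> V).

Fixpoint walk (u : V) (w : seq E) : bool :=
  if w is a :: w' then (src a == u) && walk (tgt a) w' else true.

Definition follows : rel E := fun a b => src b == tgt a.

Lemma walk_path a w : walk (tgt a) w = path follows a w.
Proof. by elim: w a => //= b w IH a; rewrite IH. Qed.

Lemma walk_unique u w w' : walk u w -> walk u w' ->
  (forall v, [seq e <- w | src e == v] = [seq e <- w' | src e == v]) -> w = w'.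
Proof.
elim: w u w' => [|a w IH] u [|b w'] //=.
- by move=> _ _ /(_ (src b)); rewrite eqxx.
- by move=> _ _ /(_ (src a)); rewrite eqxx.
move=> /andP[/eqP au wa] /andP[/eqP bu wb] eqf.
have eab : a = b by have := eqf u; rewrite au bu eqxx => -[].
subst b; congr cons; apply: IH wa wb _ => v.
by have := eqf v; case: ifP => // _ [].
Qed.

(* [u] is the current vertex and [L v] lists the unused arcs out of [v], in the
   order in which they must be used. The balance condition forces a stuck walk
   to be at [v0], with no unused arc into [v0]; since the last arc [par v] of
   each nonempty list leads towards [v0], all lists are then empty. *)
Lemma walk_exists (v0 : V) (par : V -> E) (rank : V -> nat) (L : V -> seq E) u :
  (forall v, v != v0 -> rank (tgt (par v)) < rank v) ->
  (forall v, all (fun e => src e == v) (L v)) ->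
  (forall v, v != v0 -> L v != [::] -> last (par v) (L v) = par v) ->
  (forall v, size (L v) + (v == v0) =
     \sum_y count (fun e => tgt e == v) (L y) + (v == u)) ->
  exists w, [/\ walk u w, last u (map tgt w) = v0 &
    forall v, [seq e <- w | src e == v] = L v].
Proof.
move=> rk; have [N] := ubnP (\sum_y size (L y)).
elim: N L u => // N IH L u ltN srcL lastL bal.
case Lu : (L u) => [|a l].
  have uv0 : u = v0.
    apply/eqP; have := bal u; rewrite Lu eqxx; case: (u == v0) => //=.
    by rewrite addn1.
  subst u; suff L0 v : L v = [::].
    by exists [::]; split => // v; rewrite L0.
  have [m] := ubnP (rank v); elim: m v => // m IHm v ltm.
  have [-> //|vv0] := eqVneq v v0; apply/eqP/negPn/negP => Lv.
  have pL : par v \in L v.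
    rewrite -(lastL v vv0 Lv); case: (L v) Lv => // b s _ /=; exact: mem_last.
  have inpos : 0 < \sum_y count (fun e => tgt e == tgt (par v)) (L y).
    rewrite (bigD1 v) //= addn_gt0 -has_count; apply/orP; left.
    by apply/hasP; exists (par v).
  have [e|ne] := eqVneq (tgt (par v)) v0.
    have := bal v0; rewrite Lu eqxx /=; rewrite e in inpos; lia.
  have := bal (tgt (par v)); rewrite (negbTE ne) !addn0 => sz.
  rewrite IHm ?(leq_trans (rk v vv0)) // in sz.
  by rewrite -sz in inpos.
pose L' v := if v == u then l else L v.
have sum_other (F : seq E -> nat) :
    \sum_(y | y != u) F (L' y) = \sum_(y | y != u) F (L y).
  by apply: eq_bigr => y /negbTE yu; rewrite /L' yu.
have [|v|v vv0|v|w [ww lw fw]] := IH L' (tgt a).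
- rewrite (bigD1 u) //= Lu /= in ltN.
  by rewrite (bigD1 u) //= (sum_other size) /L' eqxx; lia.
- rewrite /L'; case: eqP => [->|_] //.
  by have := srcL u; rewrite Lu => /andP[].
- rewrite /L'; case: (eqVneq v u) => [vu|_]; last exact: lastL.
  by have := lastL v vv0; rewrite vu Lu /=; case: (l) => // b s ->.
(* Using [a] removes one exit from [u] and one entry into [tgt a], while the current vertex moves
   from [u] to [tgt a]: the balance persists. *)
- have := bal v; rewrite (bigD1 u) //= Lu /=.
  rewrite (bigD1 u (P := xpredT)) //= (sum_other (count _)) /L' eqxx.
  rewrite (eq_sym v (tgt a)); set b := (_ == v :> V); case: (eqVneq v u) => [->|_].
    by rewrite Lu /=; move: (\sum_(_ | _) _) b (_ == v0) => S b c; lia.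
  by move: (\sum_(_ | _) _) b (_ == v0) => S b c; lia.
have sa : src a = u by have := srcL u; rewrite Lu /= => /andP[/eqP].
exists (a :: w); split => /=; rewrite ?sa ?eqxx //.
by move=> v; rewrite fw /L' (eq_sym v); case: eqP => [<-|].
Qed.

End Walks.

(** * Arborescences as sets of arcs decreasing a rank *)

Lemma ordS_neq k (hk : 1 < k) (t : 'I_k) : ordS t != t.
Proof.
apply/eqP => /(congr1 val) /=; case: t => t /= tk.
have [e|] := eqVneq t.+1 k; first by rewrite e modnn; lia.
by move=> ?; rewrite modn_small; lia.
Qed.

Lemma map_uniq_inj (T1 T2 : eqType) (f : T1 -> T2) (s : seq T1) :
  uniq (map f s) -> {in s &, injective f}.
Proof.
elim: s => //= a s IH /andP[fa us] x y; rewrite !inE.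
case/orP=> [/eqP->|xs] /orP[/eqP->|ys] // fxy; last exact: IH.
- by rewrite fxy map_f in fa.
- by rewrite -fxy map_f in fa.
Qed.

Section Arborescences.

Variables (k n : nat) (hk : 1 < k) (C : constellation k n).

Definition esrc (e : edge k n) : vertex C := vertex_of C e.1 e.2.
Definition etgt (e : edge k n) : vertex C := vertex_of C (ordS e.1) e.2.

Lemma tvertex_ofP t (v : tvertex C t) :
  {h | v = tvertex_of C t h}.
Proof.
case: v => X X_orb; have /sig_eqW[h eqX] : exists h, X = porbit (C t) h.
  by case/imsetP: X_orb => h _ ->; exists h.
by exists h; apply: val_inj.
Qed.

Lemma tvertex_of_eq t h h' :
  (tvertex_of C t h == tvertex_of C t h') = (h' \in porbit (C t) h).
Proof. by rewrite -val_eqE /= eq_porbit_mem porbit_sym. Qed.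

Lemma vertexP (v : vertex C) : {h | v = vertex_of C (tag v) h}.
Proof. by case: v => t v; have [h ->] := tvertex_ofP v; exists h. Qed.

Lemma vertex_ofP t h h' :
  (vertex_of C t h == vertex_of C t h') = (h' \in porbit (C t) h).
Proof. by rewrite eq_Tagged tvertex_of_eq. Qed.

Lemma etgt_neq e : etgt e != esrc e.
Proof. by apply/eqP => /(congr1 tag) /eqP; rewrite (negbTE (ordS_neq hk _)). Qed.

(** As [1 < k], the two ends of an edge have different types, so the condition on types in
    [arborescence] selects the arcs leaving [v]. *)
Lemma incident_out e (v : vertex C) :
  incident e v && (e.1 == tag v) = (esrc e == v).
Proof.
rewrite /incident -/(esrc e) -/(etgt e) (eq_sym v) (eq_sym v).
have [<-|_] /= := eqVneq (esrc e) v; first by rewrite eqxx.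
by apply/negP => /andP[/eqP <-] /=; rewrite eq_sym (negbTE (ordS_neq hk _)).
Qed.

Lemma joins_sym e (u v : vertex C) : joins e u v = joins e v u.
Proof. by rewrite /joins orbC; congr orb; exact: andbC. Qed.

(** Following tree arcs forever would close a cycle in the tree. Hence every path of tree arcs
    stops, and it can only stop at [v0]; the rank is the number of steps needed to reach [v0]. *)
Lemma arborescence_rank v0 (A : {set edge k n}) : arborescence v0 A ->
  [/\ forall e, e \in A -> esrc e != v0,
      forall v, v != v0 -> #|[pred e in A | esrc e == v]| = 1
    & exists rank : vertex C -> nat,
        forall e, e \in A -> rank (etgt e) < rank (esrc e)].
Proof.
move=> [[_ acyclic] outA].
have {}outA v : v != v0 -> #|[pred e in A | esrc e == v]| = 1.
  by move/outA <-; apply: eq_card => e; rewrite !inE incident_out.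
have [h0 _] := vertexP v0; pose e0 : edge k n := (tag v0, h0).
pose par v := odflt e0 [pick e | (e \in A) && (esrc e == v)].
pose nxt v := etgt (par v).
pose good v := (par v \in A) && (esrc (par v) == v).
have goodP v e : e \in A -> esrc e = v -> good v.
  rewrite /good /par => eA ev; case: pickP => [//|/(_ e)].
  by rewrite eA ev eqxx.
have good_out v : v != v0 -> good v.
  move=> /outA card1.
  have /card_gt0P[e] : 0 < #|[pred e in A | esrc e == v]| by rewrite card1.
  by rewrite !inE => /andP[eA /eqP]; exact: goodP.
(* An endless path repeats a vertex [y] with some period [m.+1]; the vertices of one period, with
   their tree arcs, form a forbidden cycle. *)
have not_good x : ~ forall i, good (iter i nxt x).
  move=> gx; have /trajectP[j ltj eqj] := looping_order nxt x.
  set N := fingraph.order nxt x in ltj eqj; set y := iter j nxt x in eqj.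
  have [m Nm] : exists m, N = j + m.+1 by exists (N - j).-1; lia.
  have uy : uniq (traject nxt y m.+1).
    by have := fingraph.orbit_uniq nxt x; rewrite /fingraph.orbit -/N Nm trajectD cat_uniq => /and3P[].
  have gy v : v \in traject nxt y m.+1 -> good v.
    by case/trajectP => i _ ->; rewrite /y -iterD.
  have yN : iter m.+1 nxt y = y by rewrite /y -iterD addnC -Nm eqj.
  apply/negP: (acyclic [seq (v, par v) | v <- traject nxt y m.+1]).
  rewrite negbK; apply/and5P; split => //.
  - have : fcycle nxt (traject nxt y m.+1).
      by rewrite /= -[X in rcons _ X]yN iterSr -trajectSr fpath_traject.
    rewrite cycle_map; apply: sub_in_cycle (allss _).
    move=> u v /gy /andP[_ /eqP su] _ /eqP <- /=.
    by rewrite /joins -/(esrc _) -/(etgt _) su !eqxx.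
  - by rewrite -map_comp map_id_in.
  - rewrite -map_comp (map_inj_in_uniq (f := par)); first exact: uy.
    move=> u v /gy/andP[_ /eqP su] /gy/andP[_ /eqP sv] eqp.
    by rewrite -su -sv eqp.
  - by rewrite -map_comp; apply/allP => e /mapP[v /gy/andP[pA _] ->].
(* If [v0] too had an outgoing tree arc, no path could ever stop. *)
have srcA e : e \in A -> esrc e != v0.
  move=> eA; apply/eqP => ev0; apply: (not_good v0) => i.
  by have [->|/good_out //] := eqVneq (iter i nxt v0) v0; apply: goodP eA ev0.
have reach v : exists i, iter i nxt v == v0.
  (* Bounding the number of steps by the number of vertices makes the search decidable. *)
  case: (boolP [exists i : 'I_(#|{: vertex C}|.+1), iter i nxt v == v0]).
    by case/existsP => i iv; exists i.
  rewrite negb_exists => /forallP noreach; case: (not_good v) => i.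
  apply: good_out.
  have: iter i nxt v \in fingraph.orbit nxt v by rewrite -fconnect_orbit fconnect_iter.
  case/trajectP => j ltj ->.
  have jlt : j < #|{: vertex C}|.+1.
    by rewrite ltnS (leq_trans (ltnW ltj)) // max_card.
  exact: (noreach (Ordinal jlt)).
split=> //; exists (fun v => ex_minn (reach v)) => e eA.
have nv0 := srcA e eA.
have -> : etgt e = nxt (esrc e).
  rewrite /nxt; congr etgt.
  have /andP[pA /eqP ps] := good_out _ nv0.
  apply: (card_le1_eqP (A := [pred e' in A | esrc e' == esrc e])).
  - by rewrite outA.
  - by rewrite !inE ?eA ?pA ?ps eqxx.
  - by rewrite !inE ?eA ?pA ?ps eqxx.
case: ex_minnP => i _ mini; case: ex_minnP => -[|j]; first by rewrite /= (negbTE nv0).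
by rewrite iterSr => /mini.
Qed.

(** Descending ranks connects every vertex to [v0]. On a cycle, both edges at a vertex of maximal
    rank would leave it, which contradicts the uniqueness of its outgoing arc. *)
Lemma rank_arborescence v0 (A : {set edge k n}) (rank : vertex C -> nat) :
  (forall v, v != v0 -> #|[pred e in A | esrc e == v]| = 1) ->
  (forall e, e \in A -> esrc e != v0 /\ rank (etgt e) < rank (esrc e)) ->
  arborescence v0 A.
Proof.
move=> outA srcA; have rankA e : e \in A -> rank (etgt e) < rank (esrc e).
  by case/srcA.
split; last first.
  by move=> v /outA <-; apply: eq_card => e; rewrite !inE incident_out.
pose adj := [rel x y : vertex C | [exists e in A, joins e x y]].
split; rewrite ?/spanning_connected -?/adj.
  have adj_sym : connect_sym adj.
    apply: sym_connect_sym => x y /=; apply: eq_existsb => e.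
    by rewrite joins_sym.
  have to_root v : connect adj v v0.
    have [m] := ubnP (rank v); elim: m v => // m IH v ltm.
    have [-> //|/outA card1] := eqVneq v v0.
    have /card_gt0P[e] : 0 < #|[pred e in A | esrc e == v]| by rewrite card1.
    rewrite !inE => /andP[eA /eqP ev]; rewrite -ev in ltm *.
    apply: connect_trans (IH (etgt e) _).
      by apply/connect1/existsP; exists e; rewrite eA /joins !eqxx.
    exact: leq_trans (rankA e eA) _.
  by move=> u v; rewrite (connect_trans (to_root u)) // adj_sym.
move=> c; apply/negP => /and5P[c0 cc u1 u2 cA].
have uc : uniq c by apply: map_uniq u1.
have [x xc maxx] : exists2 x, x \in c & forall y, y \in c -> rank y.1 <= rank x.1.
  case: c c0 {cc u1 u2 cA uc} => // a c _.
  elim: c a => [|b c IH] a; first by exists a => [|y]; rewrite ?inE // => /eqP->.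
  have [x xc maxx] := IH b; case: (leqP (rank a.1) (rank x.1)) => ax.
    by exists x => [|y]; rewrite inE ?xc ?orbT // => /orP[/eqP->|/maxx].
  exists a => [|y]; rewrite inE ?eqxx // => /orP[/eqP->//|/maxx].
  by move=> h; rewrite (leq_trans h) // ltnW.
pose y := prev c x; have yc : y \in c by rewrite mem_prev.
have jx := next_cycle cc xc; have jy := prev_cycle cc xc; rewrite -/y /= in jy.
have src_of (e : edge k n) (u v : vertex C) : e \in A -> rank v <= rank u ->
    joins e u v -> esrc e = u.
  move=> /rankA lt le; rewrite /joins -/(esrc e) -/(etgt e).
  by case/orP=> /andP[/eqP eu /eqP ev]; rewrite ?eu //; rewrite eu ev in le; lia.
have A2 z : z \in c -> z.2 \in A by move=> zc; apply: (allP cA); apply: map_f.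
have sx : esrc x.2 = x.1.
  by apply: src_of jx; [exact: A2 | apply: maxx; rewrite mem_next].
have jy' : joins y.2 x.1 y.1 by rewrite joins_sym.
have sy : esrc y.2 = x.1 by apply: src_of jy'; [exact: A2 | exact: maxx].
have eyx : y.2 = x.2.
  have [nv0 _] := srcA _ (A2 x xc).
  apply: (card_le1_eqP (A := [pred e in A | esrc e == x.1])).
  - by rewrite outA // -sx.
  - by rewrite !inE A2 //= ?sx ?sy eqxx.
  - by rewrite !inE A2 //= ?sx ?sy eqxx.
(* The edges of a cycle are distinct, so the cycle has length one; but the ends of an edge differ in
   type. *)
have yx : y = x := map_uniq_inj u2 yc xc eyx.
move: jy; rewrite yx /joins -/(esrc _) -/(etgt _) -sx.
by rewrite (eq_sym _ (etgt _)) (negbTE (etgt_neq _)) andbF.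
Qed.

End Arborescences.

(** * Permutations acting on arcs, and cacti as single tours *)

Section Encoding.

Variables (k n : nat) (hk : 1 < k).

(* (t, h) is the arc from type t to type t + 1 along h. The turn at its end is
   taken in such a way that the arcs run along the white faces, types
   increasing: [white_perm] goes the other way, see [iter_tour_next_white]. *)
Definition tour_next (pi : 'I_k -> {perm 'I_n}) (e : edge k n) : edge k n :=
  (ordS e.1, (pi (ordS e.1))^-1%g e.2).

(** Its cycles are the vertices, seen as cyclic orders of the arcs leaving them. *)
Definition rotor (pi : 'I_k -> {perm 'I_n}) (e : edge k n) : edge k n :=
  (e.1, pi e.1 e.2).

Lemma tour_next_inj pi : injective (tour_next pi).
Proof.
move=> [t h] [t' h'] eqe; have /= /ordS_inj tt' := congr1 fst eqe.
by subst t'; have /= /perm_inj -> := congr1 snd eqe.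
Qed.

(** This turns a successor map on arcs, read off a tour, into the permutations of a
    constellation. *)
Lemma edge_perms (rho : edge k n -> edge k n) :
  injective rho -> (forall e, (rho e).1 = e.1) ->
  exists pi : 'I_k -> {perm 'I_n}, rotor pi =1 rho.
Proof.
move=> rho_inj rho1.
have inj2 t : injective (fun h => (rho (t, h)).2).
  move=> h h' eqh; suff [] : (t, h) = (t, h') by [].
  by apply: rho_inj; rewrite [LHS]surjective_pairing [RHS]surjective_pairing !rho1 eqh.
exists (fun t => perm (@inj2 t)) => -[t h].
by rewrite /rotor permE /= [RHS]surjective_pairing rho1.
Qed.

(** In a finite group the generated subgroup consists of products of generators, so closure under
    the [pi t] suffices, without inverses. *)
Lemma transitiveP (pi : 'I_k -> {perm 'I_n}) (r : 'I_n) :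
  reflect (forall X : {set 'I_n}, r \in X ->
             (forall t h, h \in X -> pi t h \in X) -> X = setT)
    [transitive <<[set pi t | t : 'I_k]>>, on [set: 'I_n] | 'P].
Proof.
apply: (iffP idP) => [/atransP transpi X rX closedX|closed].
  apply/setP => h; rewrite inE.
  have : h \in orbit 'P <<[set pi t | t : 'I_k]>> r by rewrite transpi ?inE.
  case/orbitP => s; rewrite /= apermE => /gen_prodgP[m [c cP ->]] <-.
  elim: m c cP => [|m IH] c cP; first by rewrite big_ord0 perm1.
  rewrite big_ord_recr permM /=; have /imsetP[t _ ->] := cP ord_max.
  by apply: closedX; apply: IH => i; apply: cP.
apply/imsetP; exists r => //; symmetry.
apply: closed => [|t h hX]; first exact: orbit_refl.
apply: orbit_trans hX; apply/orbitP; exists (pi t) => //.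
by apply: mem_gen; apply: imset_f.
Qed.

Lemma coloring_of p (C : constellation k n) (f : forall t, 'I_n -> 'I_(p t)) :
  (forall t h, f t (C t h) = f t h) ->
  exists g : coloring p C, forall t h, g t (tvertex_of C t h) = f t h.
Proof.
move=> fC; exists (fun t v => f t (sval (tvertex_ofP v))) => t h.
case: (tvertex_ofP _) => h' /= /(congr1 val) /= eqh.
have : h' \in porbit (C t) h by rewrite eqh porbit_id.
case/porbitP => i ->; elim: i => [|i IH]; first by rewrite perm1.
by rewrite expgSr permM fC.
Qed.

Definition root_edge (r : 'I_n) : edge k n := (last_type hk, r).

Lemma val_iter_ord_pred i : i < k ->
  val (iter i (@ord_pred k) (last_type hk)) = k.-1 - i.
Proof.
elim: i => [|i IH] ik; first by rewrite /= subn0.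
rewrite iterS /= IH ?(ltnW ik) // (_ : (_ + k).-1 = k.-1 - i.+1 + k); last lia.
by rewrite modnDr modn_small; lia.
Qed.

Lemma iter_ord_pred_last : iter k (@ord_pred k) (last_type hk) = last_type hk.
Proof.
have -> : iter k (@ord_pred k) (last_type hk) =
    ord_pred (iter k.-1 (@ord_pred k) (last_type hk)).
  by rewrite -iterS (ltn_predK hk).
apply: val_inj; rewrite [LHS]/= val_iter_ord_pred; last lia.
by rewrite subnn add0n modn_small /=; lia.
Qed.

Lemma iter_tour_next_white (C : constellation k n) h :
  iter k (tour_next C) (root_edge (white_perm C h)) = root_edge h.
Proof.
(* [a i] is the type of the factor of [white_perm] applied at step [i]; each step of the tour undoes
   the last factor applied. *)
pose a i := iter i (@ord_pred k) (last_type hk).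
have back m : iter m (tour_next C) (a m, (\prod_(0 <= i < m) C (a i))%g h) =
    root_edge h.
  elim: m => [|m IH]; first by rewrite big_nil perm1.
  rewrite iterSr big_nat_recr //= permM -[RHS]IH; congr iter.
  by rewrite /tour_next /= ord_predK permK.
rewrite -(back k) /a iter_ord_pred_last big_mkord /white_perm.
congr (iter _ _ (_, fun_of_perm _ _)); apply: eq_bigr => i _; congr (C _).
by apply: val_inj; rewrite val_iter_ord_pred //=; lia.
Qed.

Lemma iter_tour_next_type pi m e :
  val (iter m (tour_next pi) e).1 = (e.1 + m) %% k.
Proof.
elim: m => [|m IH]; first by rewrite addn0 modn_small.
by rewrite iterS /= IH addnS -addn1 modnDml addn1.
Qed.

(** Every [k]-th arc of a tour has type [k], and the hyperedges of these arcs, read backwards, form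
    a cycle of [white_perm]. *)
Lemma cactus_tourP (C : constellation k n) (r : 'I_n) :
  is_cactus C <->
  forall e, e \in fingraph.orbit (tour_next C) (root_edge r).
Proof.
set e0 := root_edge r.
have symt := fconnect_sym (@tour_next_inj C).
split=> [cactusC [t h]|full].
  rewrite -fconnect_orbit.
  have toroot h' : fconnect (tour_next C) e0 (root_edge h').
    have : h' \in porbit (white_perm C) r.
      rewrite -eq_porbit_mem; apply/eqP.
      apply: (card_le1_eqP (A := porbits (white_perm C))).
      - by rewrite cactusC.
      - exact: imset_f.
      - exact: imset_f.
    case/porbitP => i ->; elim: i => [|i IH]; first by rewrite perm1.
    apply: connect_trans IH _; rewrite expgSr permM symt.
    rewrite -(iter_tour_next_white C ((white_perm C ^+ i)%g r)).
    exact: fconnect_iter.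
  (* This many steps lead from type index [t] to the last index [k.-1]. *)
  set e := iter (k.-1 - t) (tour_next C) (t, h).
  have -> : fconnect (tour_next C) e0 (t, h) = fconnect (tour_next C) e0 e.
    by rewrite !(symt e0); apply: same_connect => //; apply: fconnect_iter.
  suff -> : e = root_edge e.2 by [].
  rewrite [LHS]surjective_pairing; congr (_, _); apply: val_inj.
  rewrite /e iter_tour_next_type /= modn_small; have := ltn_ord t; lia.
rewrite /is_cactus; suff -> : porbits (white_perm C) = [set porbit (white_perm C) r].
  by rewrite cards1.
apply/eqP; rewrite eqEsubset sub1set imset_f // andbT.
apply/subsetP => _ /imsetP[h _ ->]; rewrite inE eq_porbit_mem.
have := full (root_edge h); rewrite -fconnect_orbit => /iter_findex.
set m := findex _ _ _ => eqm.
(* Types advance by one at each step, so the tour is back at type [k] only after whole rounds; the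
   induction is on their number [q]. *)
have /dvdnP[q mq] : k %| m.
  have /(congr1 (fun e => val e.1)) := eqm.
  rewrite iter_tour_next_type /= => em.
  suff : k.-1 + m == k.-1 + 0 %[mod k] by rewrite eqn_modDl mod0n.
  by rewrite em addn0 modn_small; lia.
rewrite mq in eqm; elim: q h eqm {mq m} => [|q IH] h eqm.
  by case: eqm => <-; exact: porbit_id.
have [h' eqh'] : exists h', h' = white_perm C h by eexists.
have /IH : iter (q * k) (tour_next C) e0 = root_edge h'.
  have inj_iter m : injective (iter m (tour_next C)).
    by elim: m => [//|m IHm] x y /tour_next_inj /IHm.
  apply: (inj_iter k).
  by rewrite eqh' iter_tour_next_white -iterD -mulSn.
have /= porbit_h := porbit_perm (white_perm C) 1 h; rewrite expg1 in porbit_h.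
by rewrite eqh' -!eq_porbit_mem porbit_h.
Qed.

End Encoding.

(** * Exits from a vertex along a tour, and last exits *)

Lemma fcycle_map (T1 T2 : eqType) (S : T1 -> T2) f g (w : seq T1) :
  injective S -> (forall x, g (S x) = S (f x)) ->
  fcycle g (map S w) = fcycle f w.
Proof.
move=> S_inj gS; rewrite cycle_map; apply: eq_cycle => x y /=.
by rewrite gS (inj_eq S_inj).
Qed.

Lemma fcycle_map_conj (T1 T2 : eqType) (S : T1 -> T2) f g (w : seq T1) :
  injective S -> uniq w -> fcycle f w -> fcycle g (map S w) ->
  {in w, forall x, g (S x) = S (f x)}.
Proof.
move=> S_inj uw fw gw x xw.
have /eqP -> := next_cycle fw xw; have /eqP -> := next_cycle gw (map_f S xw).
by rewrite next_map.
Qed.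

Lemma last_irrelevant (T : eqType) (l : seq T) x y z :
  x \in l -> last y l = last z l.
Proof. by case: l. Qed.

(** For a tour [w], these are the exits from the source of [e] in order of time. *)
Definition siblings (E V : eqType) (src : E -> V) (w : seq E) e :=
  [seq x <- w | src x == src e].

Lemma siblings_map (E E' V : eqType) (src : E -> V) (src' : E' -> V) S w e :
  (forall x, src' (S x) = src x) ->
  siblings src' (map S w) (S e) = map S (siblings src w e).
Proof.
move=> srcS; rewrite /siblings filter_map; congr map.
by apply: eq_filter => x /=; rewrite !srcS.
Qed.

Lemma eq_siblings (E V V' : eqType) (src : E -> V) (src' : E -> V') w e :
  (forall x y, (src x == src y) = (src' x == src' y)) ->
  siblings src w e = siblings src' w e.
Proof. by move=> eqs; apply: eq_filter => x; apply: eqs. Qed.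

(** The default value of [head] is harmless, since the last clause makes [w] nonempty. *)
Definition enum_from (E : eqType) (e0 : E) w :=
  [/\ uniq w, head e0 w = e0 & forall e, e \in w].

Lemma enum_from_cons (E : eqType) (e0 : E) w :
  enum_from e0 w -> w = e0 :: behead w.
Proof. by case=> _; case: w => [_ /(_ e0)|a w /= -> _]. Qed.

Lemma enum_from_map (E : eqType) (S : E -> E) e0 w :
  injective S -> (forall y, exists x, y = S x) ->
  enum_from e0 w -> enum_from (S e0) (map S w).
Proof.
move=> S_inj S_surj [uw hw fw]; split; first by rewrite map_inj_uniq.
  by case: w hw {uw fw} => //= a w ->.
by move=> y; have [x ->] := S_surj y; rewrite map_f.
Qed.

Section LastExits.

Variables (E V : eqType) (src : E -> V) (e0 : E) (w : seq E) (A : pred E).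

(** The source of [e0] is the root of the tree, so its own last exit is left out. *)
Definition last_exits := forall e,
  A e = (src e != src e0) && (e == last e (siblings src w e)).

Hypotheses (lastA : last_exits) (fullw : forall e, e \in w).

Lemma mem_siblings e : e \in siblings src w e.
Proof. by rewrite mem_filter eqxx fullw. Qed.

Lemma siblings_congr e f : src f = src e -> siblings src w f = siblings src w e.
Proof. by rewrite /siblings => ->. Qed.

Lemma last_siblings e : src e != src e0 ->
  A (last e (siblings src w e)) /\ src (last e (siblings src w e)) = src e.
Proof.
move=> ne; have : last e (siblings src w e) \in siblings src w e.
  by case: (siblings src w e) (mem_siblings e) => //= a l _; apply: mem_last.
rewrite mem_filter => /andP[/eqP eqs _]; split=> //.
by rewrite lastA eqs ne (siblings_congr eqs) (last_irrelevant _ e (mem_siblings e)) /=.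
Qed.

Lemma last_siblings_unique e f :
  A f -> src f = src e -> f = last e (siblings src w e).
Proof.
rewrite lastA => /andP[_ /eqP ef] fe.
by rewrite {1}ef (siblings_congr fe); apply: last_irrelevant (mem_siblings e).
Qed.

End LastExits.

(** * The correspondence and its compatibility with isomorphisms *)

Section Correspondence.

Variables (k : nat) (hk : 1 < k) (n : nat) (p : 'I_k -> nat).

(** The pair (type, color) is the source of the arc [e] in the Eulerian digraph; the target of [e]
    is the source of [shift e]. *)
Definition ecol (C : constellation k n) (f : coloring p C) (e : edge k n) :
    {t & 'I_(p t)} :=
  Tagged (fun t => 'I_(p t)) (f e.1 (tvertex_of C e.1 e.2)).

Definition shift (e : edge k n) : edge k n := (ordS e.1, e.2).

Lemma tvertex_of_perm (C : constellation k n) t h :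
  tvertex_of C t (C t h) = tvertex_of C t h.
Proof. by apply/eqP; rewrite tvertex_of_eq porbit_sym -{1}[C t]expg1 mem_porbit. Qed.

Lemma ecol_tour_next C (f : coloring p C) e :
  ecol f (tour_next C e) = ecol f (shift e).
Proof. by rewrite /ecol /= -[in LHS]tvertex_of_perm permKV. Qed.

Lemma ecol_rotor C (f : coloring p C) e : ecol f (rotor C e) = ecol f e.
Proof. by rewrite /ecol /= tvertex_of_perm. Qed.

(* [w] lists the arcs in the order of the Eulerian tour. The vertices of [T] are
   the color classes of [C], the arcs out of each vertex being ordered
   cyclically by their first visit, and the tree consists of the last exits. *)
Definition corresponds (C : colored_rooted_cactus n p)
    (T : labelled_tree_rooted hk n p) : Prop :=
  [/\ ecol (@crc_color _ _ _ C) =1 ecol (@ltr_label _ _ _ _ T),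
      crc_root C = ltr_root T
    & exists w, let e0 := root_edge hk (crc_root C) in
      let src := ecol (@crc_color _ _ _ C) in
      [/\ enum_from e0 w, fcycle (tour_next C) w,
          forall e, fcycle (rotor T) (siblings src w e)
        & last_exits src e0 w (mem (ltr_tree T))]].

Definition relabel (s : {perm 'I_n}) (e : edge k n) : edge k n := (e.1, s e.2).

Lemma relabel_inj s : injective (relabel s).
Proof.
move=> [t h] [t' h'] eqe; have /= tt' := congr1 fst eqe.
by subst t'; have /= /perm_inj -> := congr1 snd eqe.
Qed.

Lemma relabel_surj s e : exists e', e = relabel s e'.
Proof. by case: e => t h; exists (t, s^-1%g h); rewrite /relabel /= permKV. Qed.

Lemma relabelsP s (C D : constellation k n) :
  relabels s C D <->
  forall e, tour_next D (relabel s e) = relabel s (tour_next C e).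
Proof.
split=> [rel [t h]|rel t h].
  congr (_, _); apply: (@perm_inj _ (D (ordS t))) => /=.
  by rewrite permKV rel permKV.
have := congr1 snd (rel (ord_pred t, C t h)).
rewrite /= ord_predK permK => /(congr1 (D t)).
by rewrite permKV => ->.
Qed.

Lemma relabels_rotorP s (C D : constellation k n) :
  relabels s C D <-> forall e, rotor D (relabel s e) = relabel s (rotor C e).
Proof.
split=> [rel [t h]|rel t h]; first by rewrite /rotor /relabel /= rel.
by have /= := congr1 snd (rel (t, h)).
Qed.

Lemma relabels_coloringP s (C D : constellation k n)
    (f : coloring p C) (g : coloring p D) :
  relabels_coloring s f g <-> forall e, ecol g (relabel s e) = ecol f e.
Proof.
split=> [rel [t h]|rel t h]; first by rewrite /ecol /= rel.
by have /eqP := rel (t, h); rewrite eq_Tagged => /eqP.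
Qed.

(** The two directions make the map on classes well defined and injective. A relabelling of cacti
    carries tour to tour, hence exits to exits; conversely, rotors, root and tree determine all
    lists of exits, and these determine the tour. *)
Lemma corresponds_iso C D T U : corresponds C T -> corresponds D U ->
  cactus_iso C D <-> tree_rooted_iso T U.
Proof.
move=> [colCT rootCT [w [enumw tourw rotw lastw]]].
move=> [colDU rootDU [w' [enumw' tourw' rotw' lastw']]].
set e0 := root_edge hk _ in enumw lastw; set e0' := root_edge hk _ in enumw' lastw'.
set src := ecol _ in rotw lastw; set src' := ecol _ in rotw' lastw'.
have [uw _ fw] := enumw; have [uw' _ fw'] := enumw'.
split=> -[s].
  move=> [/relabelsP relC rootC /relabels_coloringP colC].
  have enumS := enum_from_map (@relabel_inj s) (@relabel_surj s) enumw.
  have tourS : fcycle (tour_next D) (map (relabel s) w).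
    by rewrite (fcycle_map _ (@relabel_inj s) relC).
  have root0 : relabel s e0 = e0' by rewrite /e0' rootC.
  (* Both tours start at [e0'], follow [tour_next D] and have the same length. *)
  have eqw : w' = map (relabel s) w.
    have cw' := enum_from_cons enumw'; have cS := enum_from_cons enumS.
    have [uS _ fS] := enumS.
    have /perm_size szw : perm_eq w' (map (relabel s) w).
      by apply: uniq_perm => // e; rewrite fS fw'.
    rewrite cw' cS root0; congr cons; apply: (@fcycle_head_unique _ (tour_next D) e0').
    - by rewrite -cw'.
    - by rewrite -root0 -cS.
    - by rewrite !size_behead szw.
  exists s; split.
  - apply/relabels_rotorP => e.
    have sibe := mem_siblings src fw e.
    apply: (fcycle_map_conj (@relabel_inj s) _ (rotw e) _ sibe).
      exact: filter_uniq.
    by rewrite -(siblings_map (src' := src')) // -eqw.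
  - by rewrite -rootCT -rootDU.
  - by apply/relabels_coloringP => e; rewrite -colDU -colCT colC.
  - move=> t h; have := lastw' (relabel s (t, h)); have := lastw (t, h).
    have colS e : src' (relabel s e) = src e := colC e.
    rewrite eqw (siblings_map _ _ colS) last_map -root0 !colS.
    by rewrite (inj_eq (@relabel_inj s)) => /= -> /= ->.
move=> [/relabels_rotorP relT rootT /relabels_coloringP colT treeT].
have colS e : src' (relabel s e) = src e by rewrite /src' colDU colT -colCT.
have enumS := enum_from_map (@relabel_inj s) (@relabel_surj s) enumw.
have root0 : relabel s e0 = e0' by rewrite /e0' rootDU rootT /e0 rootCT.
set W := map (relabel s) w in enumS; have [uS _ fS] := enumS.
have cw' := enum_from_cons enumw'; have cS := enum_from_cons enumS.
have permw : perm_eq w' W by apply: uniq_perm => // e; rewrite fS fw'.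
have eqsib x : siblings src' w' x = siblings src' W x.
  have [e ->] := relabel_surj s x.
  have rotS : fcycle (rotor U) (siblings src' W (relabel s e)).
    by rewrite (siblings_map _ _ colS) (fcycle_map _ (@relabel_inj s) relT).
  have szsib : size (siblings src' w' (relabel s e)) =
      size (siblings src' W (relabel s e)) by apply/perm_size/perm_filter.
  (* A cyclic order of exits becomes a list once one end is known: the first arc [e0'] at the root
     vertex, the last arc, taken from the tree, elsewhere. *)
  have [eqe|ne] := eqVneq (src e) (src e0).
    have := rotw' (relabel s e); move: rotS szsib; rewrite cw' cS root0.
    rewrite /siblings /= -root0 !colS eqe eqxx => rotS [szsib] rotw'0.
    by congr cons; apply: fcycle_head_unique rotw'0 rotS szsib.
  have ne' : src' (relabel s e) != src' e0' by rewrite -root0 !colS.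
  apply: (fcycle_last_unique (x0 := relabel s e) (rotw' _) rotS szsib).
  have [lA le] := last_siblings lastw fw ne.
  rewrite (siblings_map _ _ colS) last_map; symmetry.
  apply: (last_siblings_unique lastw' fw'); last by rewrite !colS.
  move: lA; case: (last e (siblings src w e)) => t h /=.
  by rewrite /relabel /= treeT.
pose tgt' e := src' (shift e).
have walk_of v : v = e0' :: behead v -> path.cycle (follows src' tgt') v ->
    walk src' tgt' (src' e0') v.
  move=> -> /=; rewrite eqxx /= rcons_path => /andP[+ _].
  by rewrite -walk_path.
have eqw : w' = W.
  apply: (@walk_unique _ _ src' tgt' (src' e0')).
  - apply: walk_of => //; apply: sub_cycle tourw' => x y /eqP <-.
    by rewrite /follows /src' ecol_tour_next.
  - apply: walk_of; first by rewrite -root0.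
    rewrite cycle_map; apply: sub_cycle tourw => x y /eqP <- /=.
    by rewrite /follows colS /src ecol_tour_next -/src /tgt' -colS.
  - move=> v; case: (pickP [pred x | src' x == v]) => [x /eqP <-|nov].
      exact: eqsib.
    by rewrite !(eq_filter (a2 := pred0)) ?filter_pred0.
exists s; split.
- apply/relabelsP => e.
  apply: (fcycle_map_conj (@relabel_inj s) uw tourw _ (fw e)).
  by rewrite -/W -eqw.
- by rewrite rootDU rootT rootCT.
- by apply/relabels_coloringP.
Qed.

End Correspondence.

(** * Edge counts, and a partner for every cactus and every tree-rooted constellation *)

Section Existence.

Variables (k : nat) (hk : 1 < k) (n : nat) (p : 'I_k -> nat).

Definition vcol (C : constellation k n) (f : coloring p C) (v : vertex C) :
    {t & 'I_(p t)} :=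
  Tagged (fun t => 'I_(p t)) (f (tag v) (tagged v)).

Lemma vcol_inj (C : constellation k n) (f : coloring p C) :
  (forall t, injective (@f t)) -> injective (vcol f).
Proof.
move=> f_inj [t u] [t' u'] eqc; have /= tt' := congr1 tag eqc; subst t'.
by move/eqP: eqc; rewrite eq_Tagged /= => /eqP /f_inj ->.
Qed.

Lemma ecol_vcol (C : constellation k n) (f : coloring p C) e :
  ecol f e = vcol f (esrc C e).
Proof. by []. Qed.

Lemma ecol_esrc (C : constellation k n) (f : coloring p C) e e' :
  (forall t, injective (@f t)) -> (ecol f e == ecol f e') = (esrc C e == esrc C e').
Proof. by move=> f_inj; rewrite !ecol_vcol (inj_eq (vcol_inj f_inj)). Qed.

Lemma ecol_Tagged (C : constellation k n) (f : coloring p C) t h s (i : 'I_(p s)) :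
  ecol f (t, h) = Tagged _ i -> t = s /\ f s (tvertex_of C s h) = i.
Proof.
move=> eqi; have /= ts := congr1 tag eqi; subst t; split=> //.
by move/eqP: eqi; rewrite eq_Tagged => /eqP.
Qed.

(** The count depends only on the colors at the two ends of each arc, which corresponding objects
    share. The second alternative can occur only for [k = 2]. *)
Lemma num_joiningE (C : constellation k n) (f : coloring p C) t
    (i : 'I_(p t)) (j : 'I_(p (ordS t))) :
  let I := Tagged (fun t => 'I_(p t)) i in
  let J := Tagged (fun t => 'I_(p t)) j in
  num_joining f i j =
  #|[pred e | (ecol f e == I) && (ecol f (shift e) == J) ||
              (ecol f e == J) && (ecol f (shift e) == I)]|.
Proof.
move=> I J; apply: eq_card => -[s h]; rewrite !inE.
apply/existsP/orP => [[u /existsP[v /and3P[juv /eqP fu /eqP fv]]]|ecols].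
  have uI : vcol f (Tagged (tvertex C) u) = I by rewrite /vcol /= fu.
  have vJ : vcol f (Tagged (tvertex C) v) = J by rewrite /vcol /= fv.
  by case/orP: juv => /andP[/eqP eu /eqP ev]; [left|right];
    rewrite !ecol_vcol /esrc /= -eu -ev uI vJ !eqxx.
exists (tvertex_of C t h); apply/existsP; exists (tvertex_of C (ordS t) h).
rewrite /joins -/(vertex_of C t h) -/(vertex_of C (ordS t) h) /=.
case: ecols => /andP[/eqP /ecol_Tagged[-> <-] /eqP /ecol_Tagged[e <-]].
  by rewrite !eqxx.
by rewrite e !eqxx orbT.
Qed.

Lemma num_joining_iso (C D : colored_rooted_cactus n p) t i j :
  cactus_iso C D ->
  num_joining (crc_color (c := C)) (t := t) i j =
  num_joining (crc_color (c := D)) i j.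
Proof.
case=> s [_ _ /relabels_coloringP colS].
rewrite !num_joiningE -!sum1_card.
rewrite [RHS](reindex_inj (@relabel_inj _ _ s)).
by apply: eq_bigl => e; rewrite !inE -!colS.
Qed.

Lemma num_joining_corresponds (C : colored_rooted_cactus n p)
    (T : labelled_tree_rooted hk n p) t i j :
  corresponds C T ->
  num_joining (crc_color (c := C)) (t := t) i j =
  num_joining (ltr_label (l := T)) i j.
Proof.
case=> colCT _ _; rewrite !num_joiningE; apply: eq_card => e.
by rewrite !inE !colCT.
Qed.

Lemma iter_rotor (pi : 'I_k -> {perm 'I_n}) i t h :
  iter i (rotor pi) (t, h) = (t, (pi t ^+ i)%g h).
Proof. by elim: i => [|i IH]; rewrite ?perm1 // iterS IH expgSr permM. Qed.

Lemma fconnect_rotor (pi : 'I_k -> {perm 'I_n}) t h h' :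
  fconnect (rotor pi) (t, h) (t, h') = (h' \in porbit (pi t) h).
Proof.
apply/idP/porbitP => [/iter_findex|[i ->]].
  by rewrite iter_rotor => /(congr1 snd) /= <-; eexists.
by rewrite -iter_rotor fconnect_iter.
Qed.

Lemma index_next (T : eqType) (x0 x : T) w :
  enum_from x0 w -> next w x != x0 -> index (next w x) w = (index x w).+1.
Proof.
move=> enumw; have [uw _ fw] := enumw; have cw := enum_from_cons enumw.
rewrite next_nth fw {1 3}cw.
have [lt ne|ge] := ltnP (index x w) (size (behead w)); last first.
  by rewrite nth_default // eqxx.
have -> : nth x0 (behead w) (index x w) = nth x0 w (index x w).+1 by rewrite nth_behead.
by rewrite index_uniq //; move: lt; rewrite size_behead; lia.
Qed.

(** The exits from each color class, closed up cyclically, give the rotors, and the last exits give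
    the tree. The tree is oriented to the root because the arc following a last exit leaves its
    target, so the target has a later last exit or is the root. *)
Lemma cactus_corresponds (C : colored_rooted_cactus n p) :
  exists T : labelled_tree_rooted hk n p, corresponds C T.
Proof.
set r := crc_root C; set e0 := root_edge hk r.
pose src := ecol (crc_color (c := C)).
pose w := fingraph.orbit (tour_next C) e0.
have enumw : enum_from e0 w.
  split; [exact: fingraph.orbit_uniq| |exact/cactus_tourP/crc_cactus].
  by rewrite /w /fingraph.orbit -orderSpred.
have tourw : fcycle (tour_next C) w := cycle_orbit (@tour_next_inj _ _ C) e0.
have [uw _ fw] := enumw.
pose rho e := next (siblings src w e) e.
have usib e : uniq (siblings src w e) by rewrite filter_uniq.
have src_rho e : src (rho e) = src e.
  have : rho e \in siblings src w e by rewrite mem_next mem_siblings.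
  by rewrite mem_filter => /andP[/eqP].
have rho_inj : injective rho.
  move=> x y eqr; have eqs : src x = src y by rewrite -src_rho eqr src_rho.
  rewrite -(prev_next (usib x) x) -(prev_next (usib y) y).
  by rewrite -/(rho x) -/(rho y) eqr /siblings eqs.
have [e|pi rotpi] := edge_perms rho_inj; first by have /= := congr1 tag (src_rho e).
have rotw e : fcycle (rotor pi) (siblings src w e).
  apply: sub_in_cycle (allss _) (cycle_next (usib e)) => x y.
  rewrite mem_filter => /andP[/eqP sx _] _ /eqP <- /=.
  by rewrite rotpi /rho /siblings sx.
have porbit_src t h h' : (h' \in porbit (pi t) h) = (src (t, h) == src (t, h')).
  rewrite -fconnect_rotor; apply/idP/eqP => [/iter_findex <-|eqs].
    elim: (findex _ _ _) => //= m IH.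
    by rewrite rotpi src_rho.
  by apply: (connect_cycle (rotw (t, h))); rewrite mem_filter fw ?eqs eqxx.
have transpi : [transitive <<[set pi t | t : 'I_k]>>, on [set: 'I_n] | 'P].
  apply/(transitiveP _ r) => X rX closedX.
  (* Each cycle of [C t] lies in a single cycle of [pi t], so transitivity passes from [C] to
     [pi]. *)
  apply: (transitiveP C r (constellation_transitive C)) => // t h hX.
  have : C t h \in porbit (pi t) h.
    by rewrite porbit_src eq_sym; apply/eqP; exact: (ecol_rotor _ (t, h)).
  case/porbitP => i ->; elim: i => [|i IH]; first by rewrite perm1.
  by rewrite expgSr permM closedX.
pose D := Constellation transpi.
have [t h|g gE] := @coloring_of _ _ p D (fun t h => crc_color (tvertex_of C t h)).
  have := mem_porbit (pi t) 1 h; rewrite porbit_src eq_sym /src /ecol eq_Tagged.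
  by move/eqP.
have ecolD : ecol (crc_color (c := C)) =1 ecol g by move=> e; rewrite /ecol gE.
have g_inj t : injective (@g t).
  move=> u v; have [h ->] := tvertex_ofP u; have [h' ->] := tvertex_ofP v.
  rewrite !gE => eqg; apply/eqP.
  by rewrite tvertex_of_eq porbit_src eq_Tagged /=; apply/eqP.
have typeD t : #|tvertex D t| = p t.
  rewrite -[RHS]card_ord; apply: (bij_eq_card (f := @g t)).
  apply: (inj_card_bij (@g_inj t)).
  rewrite -(card_codom (@g_inj t)); apply/subset_leq_card/subsetP => i _.
  have [u <-] := @crc_color_surj _ _ _ C t i; have [h ->] := tvertex_ofP u.
  by rewrite -gE codom_f.
pose A := [set e | (src e != src e0) && (e == last e (siblings src w e))].
have lastA : last_exits src e0 w (mem A) by move=> e; rewrite -[LHS]/(e \in A) inE.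
have eqsrc x y : (src x == src y) = (esrc D x == esrc D y).
  by rewrite /src !ecolD ecol_esrc.
have arbA : arborescence (root_vertex hk D r) A.
  pose v0 := esrc D e0; change (arborescence v0 A).
  pose lastexit v := last e0 [seq x <- w | esrc D x == v].
  (* The rank measures the time left after the last exit; it is set to 0 at the root vertex and is
     positive elsewhere. *)
  pose rank v := if v == v0 then 0 else size w - index (lastexit v) w.
  apply: (rank_arborescence hk (rank := rank)) => [v vv0|e eA].
    have [h vh] := vertexP v; rewrite -/(esrc D (tag v, h)) in vh.
    set e := (tag v, h) in vh; rewrite vh -eqsrc in vv0.
    have [lA lsrc] := last_siblings lastA fw vv0.
    rewrite -(card1 (last e (siblings src w e))); apply: eq_card => x.
    rewrite !inE; apply/andP/eqP => [[xA xv]|->].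
      rewrite vh -eqsrc in xv; apply: (last_siblings_unique lastA) => //.
        by rewrite /= inE.
      exact/eqP.
    by move: lA; rewrite /= inE => ->; rewrite vh -eqsrc lsrc.
  have := eA; rewrite inE => /andP[ne0 /eqP elast]; rewrite eqsrc in ne0.
  split=> //; rewrite /rank (negbTE ne0).
  have ltw x : index x w < size w by rewrite index_mem.
  have -> : lastexit (esrc D e) = e.
    rewrite [RHS]elast (eq_siblings _ _ (src' := esrc D)) //.
    by apply: (last_irrelevant (x := e)); apply: mem_siblings.
  case: ifP => [_|/negbT ne1]; first by rewrite subn_gt0 ltw.
  set e1 := next w e.
  have src1 : esrc D e1 = etgt D e.
    rewrite -[etgt D e]/(esrc D (shift e)); apply/eqP; rewrite -eqsrc.
    by rewrite /e1 -(eqP (next_cycle tourw (fw e))) /src ecol_tour_next.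
  (* The tour does not wrap around after [e]: its target is not [v0], so the next arc is not
     [e0]. *)
  have idx1 : index e1 w = (index e w).+1.
    by apply: (index_next enumw); apply: contraNneq ne1 => eq0; rewrite -src1 /e1 eq0.
  apply: ltn_sub2l => //.
  rewrite -idx1; apply: index_le_last_filter => //.
  by rewrite mem_filter fw src1 eqxx.
pose T := @LTRooted _ hk _ p D typeD r g g_inj A arbA.
by exists T; split=> //; exists w; split.
Qed.

(** The rotors, cut open according to root and tree, prescribe lists of exits; the walk using them
    is an Eulerian tour, from which the permutations of the cactus are read. *)
Lemma tree_corresponds (T : labelled_tree_rooted hk n p) :
  exists C : colored_rooted_cactus n p, corresponds C T.
Proof.
set r := ltr_root T; set e0 := root_edge hk r; set A := ltr_tree T.
have lab_inj := @ltr_label_inj _ _ _ _ T.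
pose src := esrc T; pose tgt e := src (shift e); pose v0 := src e0.
have [srcA outA [rank rankA]] := arborescence_rank hk (ltr_arborescence T).
rewrite -/(esrc T e0) -/A -/src -/v0 in srcA outA rankA.
pose rho := rotor T.
have rho_inj : injective rho.
  move=> [t h] [t' h'] eqe; have /= tt' := congr1 fst eqe.
  by subst t'; have /= /perm_inj -> := congr1 snd eqe.
have orbit_src x e : (e \in fingraph.orbit rho x) = (src e == src x).
  rewrite -fconnect_orbit; case: x e => [t h] [t' h'].
  apply/idP/eqP => [|eqs].
    move=> cxe; have := iter_findex cxe; rewrite iter_rotor => -[-> <-].
    apply/eqP; rewrite [_ == _]eq_sym vertex_ofP; exact: mem_porbit.
  have /= tt' := congr1 tag eqs; subst t'; rewrite fconnect_rotor -vertex_ofP.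
  by rewrite eq_sym; apply/eqP.
pose par v := odflt e0 [pick e | (e \in A) && (src e == v)].
have parP v : v != v0 -> par v \in A /\ src (par v) = v.
  move=> /outA card1; rewrite /par; case: pickP => [e /andP[eA /eqP]|none] //.
  by rewrite (eq_card0 none) in card1.
have par_src e : e \in A -> par (src e) = e.
  move=> eA; have ne := srcA e eA; have [pA ps] := parP _ ne.
  apply: (card_le1_eqP (A := [pred e' in A | src e' == src e])).
  - by rewrite outA.
  - by rewrite !inE ?pA ?eA ?ps eqxx.
  - by rewrite !inE ?pA ?eA ?ps eqxx.
(* The list starts with [e0] at the root vertex; elsewhere the rotation by one moves the tree arc
   [par v] to the end. *)
pose L v := if v == v0 then fingraph.orbit rho e0
            else rot 1 (fingraph.orbit rho (par v)).
have uL v : uniq (L v).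
  by rewrite /L; case: ifP => _; rewrite ?rot_uniq fingraph.orbit_uniq.
have cL v : fcycle rho (L v).
  by rewrite /L; case: ifP => _; rewrite ?rot_cycle cycle_orbit.
have memL v e : (e \in L v) = (src e == v).
  rewrite /L; case: eqVneq => [->|ne]; first by rewrite orbit_src.
  by rewrite mem_rot orbit_src; have [_ ->] := parP v ne.
have lastL x v : v != v0 -> last x (L v) = par v.
  rewrite /L => /negbTE ->; rewrite /fingraph.orbit -orderSpred /= rot1_cons.
  by rewrite last_rcons.
have countL P v : count P (L v) = \sum_(e | P e && (src e == v)) 1.
  rewrite -size_filter -(card_uniqP (filter_uniq P (uL v))) -sum1_card.
  by apply: eq_bigl => e; rewrite mem_filter memL.
have [|||v|w [ww lw fw]] := @walk_exists _ _ src tgt v0 par rank L v0.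
- by move=> v /parP[pA {2}<-]; exact: rankA.
- by move=> v; apply/allP => e; rewrite memL.
- by move=> v vv0 _; exact: lastL.
(* Balance: [shift] matches the arcs entering [v] with those leaving [v], along the same
   hyperedges. *)
- congr addn; rewrite -(count_predT (L v)) countL (reindex_inj (h := @shift k n)).
    rewrite (partition_big src xpredT) //=.
    by apply: eq_bigr => y _; rewrite countL.
  by move=> [t h] [t' h'] eqe; have /= /ordS_inj -> := congr1 fst eqe;
    have /= -> := congr1 snd eqe.
have allw e : e \in w.
  by have := memL (src e) e; rewrite -fw mem_filter eqxx.
have uw : uniq w.
  apply: count_mem_uniq => e; rewrite allw.
  have := count_uniq_mem e (uL (src e)); rewrite memL eqxx -fw count_filter => <-.
  by apply: eq_count => x /=; case: eqVneq => // ->; rewrite eqxx.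
have headw : head e0 w = e0.
  case: w ww {lw allw uw} fw => //= a w /andP[/eqP av0 _] fw.
  by have := fw v0; rewrite av0 eqxx /L eqxx /fingraph.orbit -orderSpred => -[].
have enumw : enum_from e0 w by [].
have cw : path.cycle (follows src tgt) w.
  have cw := enum_from_cons enumw; move: ww lw; rewrite cw /= => /andP[_ ww].
  by rewrite rcons_path -walk_path ww last_map => lw; rewrite /follows lw eqxx.
(* The arc [(ord_pred x.1, x.2)] enters the source of [x] along the same hyperedge; [sigma] returns
   the exit that the tour takes after it. Since [tour_next] turns by inverses, [pi] is the inverse
   of the resulting [q]. *)
pose sigma x := next w (ord_pred x.1, x.2).
have src_sigma x : src (sigma x) = src x.
  have /eqP -> := next_cycle cw (allw (ord_pred x.1, x.2)).
  by rewrite /tgt /shift /= ord_predK -surjective_pairing.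
have sigma_inj : injective sigma.
  move=> [t h] [t' h'] /(congr1 (prev w)); rewrite !prev_next // => eqe.
  have /= /(congr1 (@ordS k)) := congr1 fst eqe; rewrite !ord_predK => ->.
  by have /= -> := congr1 snd eqe.
have [e|q rotq] := edge_perms sigma_inj; first by have /= := congr1 tag (src_sigma e).
pose pi t := (q t)^-1%g.
have tour_pi e : tour_next pi e = next w e.
  have -> : tour_next pi e = rotor q (shift e) by rewrite /tour_next /pi invgK.
  by rewrite rotq /sigma /= ordSK -surjective_pairing.
have tourw : fcycle (tour_next pi) w.
  by rewrite (eq_cycle (e' := frel (next w))) ?cycle_next // => x y /=; rewrite tour_pi.
have iter_w e : exists i, e = iter i (tour_next pi) e0.
  have := connect_cycle tourw (allw e0) (allw e).
  by move/iter_findex => <-; eexists.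
have transpi : [transitive <<[set pi t | t : 'I_k]>>, on [set: 'I_n] | 'P].
  apply/(transitiveP _ r) => X rX closedX.
  (* A permutation mapping a finite set into itself maps it onto itself, so [X] is closed under the
     turns of the tour, which visits every hyperedge. *)
  have closedV t h : h \in X -> (pi t)^-1%g h \in X.
    have /eqP eqX : pi t @: X == X.
      rewrite eqEcard card_imset ?leqnn ?andbT; last exact: perm_inj.
      by apply/subsetP => _ /imsetP[x xX ->]; apply: closedX.
    by rewrite -{1}eqX => /imsetP[x xX ->]; rewrite permK.
  apply/setP => h; rewrite inE; have [i] := iter_w (root_edge hk h).
  move=> /(congr1 snd) /= ->; elim: i => //= i IH; exact: closedV.
pose D := Constellation transpi.
have cactusD : is_cactus D.
  by apply/(cactus_tourP hk D r) => e; rewrite -fconnect_orbit (connect_cycle tourw).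
have [t h|g gE] := @coloring_of _ _ p D (fun t h => ltr_label (tvertex_of T t h)).
  congr (ltr_label _); apply/eqP; rewrite tvertex_of_eq -vertex_ofP.
  have := src_sigma (t, D t h); rewrite -rotq /rotor /= permKV => eqs.
  by rewrite -[X in X == _]eqs.
have ecolD : ecol g =1 ecol (ltr_label (l := T)) by move=> e; rewrite /ecol gE.
have surjD t (i : 'I_(p t)) : exists v : tvertex D t, g t v = i.
  have /codomP[u ->] : i \in codom (@ltr_label _ _ _ _ T t).
    apply: (inj_card_onto (lab_inj t)).
    by rewrite ltr_type -[X in _ <= X]card_ord.
  have [h ->] := tvertex_ofP u; exists (tvertex_of D t h); exact: gE.
exists (@CRCactus _ _ p D cactusD r g surjD); split=> //.
have eqsrc x y : (ecol g x == ecol g y) = (src x == src y).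
  by rewrite !ecolD ecol_esrc.
have sibE e : siblings (ecol g) w e = L (src e).
  by rewrite (eq_siblings _ _ eqsrc) /siblings fw.
exists w; split=> // [e|e]; rewrite sibE //=.
rewrite eqsrc -/v0; apply/idP/andP => [eA|[ne /eqP ->]].
  by have ne := srcA e eA; rewrite lastL // par_src.
by rewrite lastL //; have [] := parP _ ne.
Qed.

End Existence.

(* The bijection between isomorphism classes *)
From mathcomp Require Import classical_sets functions.

Theorem theorem3p1 (k : nat) (hk : 1 < k) (n : nat) (hn : 0 < n)
    (p : 'I_k -> nat) (hp : forall t : 'I_k, 0 < p t) :
  exists Phi : set (colored_rooted_cactus n p) ->
               set (labelled_tree_rooted hk n p),
    set_bij (cacti n p) (tree_rooted hk n p) Phi /\
    (forall (C : colored_rooted_cactus n p) (T : labelled_tree_rooted hk n p),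
       Phi (cactus_iso C) T ->
       forall (t : 'I_k) (i : 'I_(p t)) (j : 'I_(p (ordS t))),
         num_joining (crc_color (c := C)) i j =
         num_joining (ltr_label (l := T)) i j).
Proof.
(* Defined as the image under the relation [corresponds], [Phi] requires no choice of
   representatives; [PhiE] shows that it sends classes to classes. *)
pose Phi (X : set (colored_rooted_cactus n p)) : set (labelled_tree_rooted hk n p) :=
  fun T => exists2 C, X C & corresponds C T.
have PhiE C T : corresponds C T -> Phi (cactus_iso C) = tree_rooted_iso T.
  move=> CT; apply/seteqP; split=> U.
    by case=> D CD DU; apply/(corresponds_iso CT DU).
  have [D DU] := tree_corresponds U.
  by move=> TU; exists D => //; apply/(corresponds_iso CT DU).
exists Phi; split.
  split.
  - move=> _ [C _ <-]; have [T CT] := cactus_corresponds hk C.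
    by rewrite (PhiE _ _ CT); exists T.
  - move=> X Y /set_mem[C _ <-] /set_mem[D _ <-].
    have [T CT] := cactus_corresponds hk C.
    have [U DU] := cactus_corresponds hk D.
    rewrite (PhiE _ _ CT) (PhiE _ _ DU) => eqTU.
    (* Membership of [B] in either class is transported to its partner [V], where the two classes
       are equal by assumption. *)
    apply/seteqP; split=> B; have [V BV] := cactus_corresponds hk B => iB.
      by apply/(corresponds_iso DU BV); rewrite -eqTU; apply/(corresponds_iso CT BV).
    by apply/(corresponds_iso CT BV); rewrite eqTU; apply/(corresponds_iso DU BV).
  - move=> _ [T _ <-]; have [C CT] := tree_corresponds T.
    by exists (cactus_iso C); [exists C | exact: PhiE].
move=> C T [D CD DT] t i j.
by rewrite (num_joining_iso i j CD) (num_joining_corresponds i j DT).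
Qed.
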